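(* Let $p=p(n)$ satisfy $p=o\left(\frac1n\right)$, and consider majority bootstrap percolation on $G_{n,p}$ with $A(0)=A_0(n)$ initially active vertices and final active set of size $A^*$. Then for every $\varepsilon>0$, $$\lim_{n\to\infty}\mathbb P\{A^*>(1+\varepsilon)A(0)\}=0,$$ that is, $A^*=A(0)(1+o_{\mathrm p}(1))$.
   Context: $G_{n,p}$ is the random graph on $V_n=\{1,\dots,n\}$ in which each possible edge is present independently with probability $p=p(n)$. Majority bootstrap percolation: start with a set $\mathcal A(0)\subseteq V_n$ of $A(0)=A_0(n)$ initially active vertices, chosen without reference to the edges of the graph. An inactive vertex $v$ becomes active as soon as its number of active neighbours is at least $\max\left(\tfrac12\deg(v),1\right)$, i.e. it has at least one active neighbour and at least half of its neighbours are active. Active vertices stay active. This is repeated until no more vertices become active; $\mathcal A^*$ is the final active set and $A^*=|\mathcal A^*|$. All limits are as $n\to\infty$. $o_{\mathrm p}(1)$ denotes a random quantity converging to $0$ in probability. *)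

(* Defs.v *)
From HB Require Import structures.
From mathcomp Require Import all_boot all_order all_algebra.
From mathcomp Require Import reals.

Set Implicit Arguments.
Unset Strict Implicit.
Unset Printing Implicit Defensive.

Import Order.TTheory GRing.Theory Num.Theory.

Local Open Scope ring_scope.

(* A simple graph on the vertex set 'I_n is given by its set of edges, an edge
   being a set of exactly two vertices. *)
Definition all_edges (n : nat) : {set {set 'I_n}} :=
  [set e : {set 'I_n} | #|e| == 2%N].

Definition graphs (n : nat) : {set {set {set 'I_n}}} := powerset (all_edges n).

Definition adj (n : nat) (G : {set {set 'I_n}}) (u v : 'I_n) : bool :=
  [set u; v] \in G.

Definition deg (n : nat) (G : {set {set 'I_n}}) (v : 'I_n) : nat :=
  #|[set u | adj G u v]|.

Definition active_deg (n : nat) (G : {set {set 'I_n}}) (A : {set 'I_n})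
    (v : 'I_n) : nat :=
  #|[set u in A | adj G u v]|.

Definition activates (n : nat) (G : {set {set 'I_n}}) (A : {set 'I_n})
    (v : 'I_n) : bool :=
  (0 < active_deg G A v)%N && (deg G v <= 2 * active_deg G A v)%N.

Definition step (n : nat) (G : {set {set 'I_n}}) (A : {set 'I_n}) :
    {set 'I_n} :=
  A :|: [set v | activates G A v].

(* Every round that is not the last one activates a vertex, so n rounds
   suffice for the process to stop: see step_final. *)
Definition final (n : nat) (G : {set {set 'I_n}}) (A : {set 'I_n}) :
    {set 'I_n} :=
  iter n (step G) A.

Lemma step_final (n : nat) (G : {set {set 'I_n}}) (A : {set 'I_n}) :
  step G (final G A) = final G A.
Proof.
suff H k : step G (iter k (step G) A) = iter k (step G) A \/
           (k <= #|iter k (step G) A|)%N.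
  case: (H n) => // le_n.
  have E : final G A = [set: 'I_n].
    by apply/eqP; rewrite eqEcard subsetT cardsT card_ord.
  by rewrite E /step setTU.
elim: k => [|k [IH|IH]]; first by right.
  by left; rewrite iterS IH.
have [E|ne] := eqVneq (step G (iter k (step G) A)) (iter k (step G) A).
  by left; rewrite iterS E.
right; rewrite iterS; apply: leq_ltn_trans IH _.
by apply: proper_card; rewrite properEneq eq_sym ne /= subsetUl.
Qed.

Section Probability.
Context {R : realType}.

Definition gnp (n : nat) (q : R) (G : {set {set 'I_n}}) : R :=
  \prod_(e in all_edges n) (if e \in G then q else 1 - q).

Lemma sum_gnp (n : nat) (q : R) : \sum_(G in graphs n) gnp q G = 1.
Proof.
pose F e : R := if e \in all_edges n then q else 0.
pose H e : R := if e \in all_edges n then 1 - q else 1.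
have FH : \prod_e (F e + H e) = 1.
  by apply: big1 => e _; rewrite /F /H; case: ifP => _; rewrite ?add0r // subrKC.
have FH' : \sum_(G : {set {set 'I_n}})
    \prod_e (if e \in G then F e else H e) = 1.
  by apply: etrans FH; rewrite bigA_distr; apply: eq_bigl => G; rewrite inE.
apply: etrans FH'.
rewrite [RHS](bigID (mem (graphs n))) /=.
rewrite [X in _ + X]big1 ?addr0 => [|G]; last first.
  rewrite powersetE => /subsetPn[e eG eE].
  by rewrite (bigD1 e) //= eG /F (negPf eE) mul0r.
apply: eq_bigr => G; rewrite powersetE => sG.
rewrite /gnp big_mkcond; apply: eq_bigr => e _; rewrite /F /H.
by case: ifP => // /negbT eE; rewrite ifN //; apply: contra eE; exact: (subsetP sG).
Qed.

(* Law of a random set of exactly a vertices. *)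
Definition seed_law (n a : nat) (mu : {set 'I_n} -> R) : Prop :=
  [/\ forall A, 0 <= mu A,
      \sum_(A : {set 'I_n}) mu A = 1 &
      forall A, mu A != 0 -> #|A| = a].

(* Probability of the event E A G, where the initial set A has law mu, the
   graph G has law G_{n,q}, and A and G are independent. *)
Definition Pr (n : nat) (mu : {set 'I_n} -> R) (q : R)
    (E : {set 'I_n} -> {set {set 'I_n}} -> bool) : R :=
  \sum_(A : {set 'I_n}) \sum_(G in graphs n | E A G) mu A * gnp q G.

End Probability.

(* Main.v *)
Require Import Defs.
From mathcomp Require Import all_boot all_order all_algebra.
From mathcomp Require Import all_classical all_reals all_analysis.
From mathcomp Require Import lra.

Import Order.TTheory GRing.Theory Num.Theory.
Import numFieldNormedType.Exports.

(** Activation spreads along edges only, since an inactive vertex needs an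
    active neighbour.  Hence [final G A] lies in the union of the connected
    components that meet [A] ([final_sub_reach]).  A vertex that is connected
    to [a] is the endpoint of a self-avoiding path starting at [a]; there are
    at most [n ^ k] such paths with [k] edges in the complete graph, and each
    one is contained in the random graph with probability [q ^ k], because its
    edges are distinct ([sum_gnp_sup], [card_path_edges]).  With [x := n q] this gives

      E |final G A|  <=  |A| (1 + x + x ^ 2 + ...)  <=  |A| (1 + 2 x)

    as soon as [x <= 1/2] ([expected_final]).  Markov's inequality for the
    nonnegative variable [|final G A| - |A|] bounds the probability that it
    exceeds [eps |A|] by [2 x / eps], uniformly in the initial set
    ([Pr_final_large]), and [x] tends to 0 by assumption.

    For the multiplicative form, the relative excess [|final G A| / |A| - 1] is
    nonnegative, so that the events of its convergence in probability to 0 are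
    those of the first part. *)

(** * Edge sets of paths *)

Local Open Scope nat_scope.

Fixpoint path_edges {T : finType} (x : T) (s : seq T) : {set {set T}} :=
  if s is y :: s' then ([set x; y] |: path_edges y s')%SET else finset.set0.

Lemma path_adjE {n : nat} (G : {set {set 'I_n}}) (a : 'I_n) (s : seq 'I_n) :
  path (adj G) a s = (path_edges a s \subset G).
Proof.
elim: s a => [|b s IH] a /=; first by rewrite finset.sub0set.
by rewrite finset.subUset finset.sub1set IH.
Qed.

Lemma mem_path_edges {T : finType} (x : T) (s : seq T) (e : {set T}) :
  e \in path_edges x s -> {subset e <= x :: s}.
Proof.
elim: s x => [|y s IH] x /=; first by rewrite inE.
case/setU1P => [->|/IH sub] z; first by rewrite !inE => /orP[]->; rewrite ?orbT.
by move=> /sub zs; rewrite inE zs orbT.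
Qed.

(** The first vertex of a self-avoiding path is incident to no edge other than
    the first one, so no edge is repeated. *)
Lemma card_path_edges {T : finType} (x : T) (s : seq T) :
  uniq (x :: s) -> #|path_edges x s| = size s.
Proof.
elim: s x => [|y s IH] x; first by rewrite /= cards0.
rewrite cons_uniq => /andP[xs us] /=; rewrite cardsU1 (IH _ us).
suff -> : ([set x; y] \notin path_edges y s)%SET by [].
by apply: contra xs => /mem_path_edges; apply; rewrite set21.
Qed.

Lemma path_edges_sub {n : nat} (a : 'I_n) (s : seq 'I_n) :
  uniq (a :: s) -> path_edges a s \subset all_edges n.
Proof.
elim: s a => [|b s IH] a; first by rewrite /= finset.sub0set.
rewrite cons_uniq inE negb_or => /andP[/andP[ab _] us] /=.
by rewrite finset.subUset finset.sub1set IH // inE cards2 ab.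
Qed.

(** * Reachability from the initial set *)

Lemma sub_iter_step {n : nat} (G : {set {set 'I_n}}) (A : {set 'I_n})
  (k : nat) : A \subset iter k (step G) A.
Proof.
by elim: k => //= k IH; apply: fintype.subset_trans IH (finset.subsetUl _ _).
Qed.

Lemma final_sub_reach {n : nat} (G : {set {set 'I_n}}) (A : {set 'I_n})
    (v : 'I_n) :
  v \in final G A -> exists2 a, a \in A & connect (adj G) a v.
Proof.
rewrite /final; move: (X in iter X) => k.
elim: k v => [|k IH] v /=; first by move=> vA; exists v.
rewrite finset.in_setU => /orP[/IH //|]; rewrite inE => /andP[+ _].
rewrite card_gt0 => /finset.set0Pn[u]; rewrite inE => /andP[/IH[a aA au] uv].
by exists a => //; apply: connect_trans au (connect1 uv).
Qed.

Lemma final0 {n : nat} (G : {set {set 'I_n}}) :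
  final G finset.set0 = finset.set0.
Proof.
apply/finset.setP => v; rewrite inE; apply/negP => /final_sub_reach[a].
by rewrite inE.
Qed.

(** A self-avoiding path from [a] with [k] edges is recorded by its [k] vertices
    after [a], so that paths of length [k] form a finite type of size [n ^ k]. *)
Definition saw {n : nat} (G : {set {set 'I_n}}) (k : nat) (a : 'I_n) :
    {set k.-tuple 'I_n} :=
  [set s : k.-tuple 'I_n | uniq (a :: s) & path (adj G) a s]%SET.

Lemma card_component_le {n : nat} (G : {set {set 'I_n}}) (a : 'I_n) :
  #|connect (adj G) a| <= \sum_(k < n) #|saw G k a|.
Proof.
pose ends (k : 'I_n) := [set last a s | s : k.-tuple 'I_n in saw G k a]%SET.
have sub : connect (adj G) a \subset (\bigcup_(k < n) ends k)%SET.
  apply/fintype.subsetP => v /connectP[s0 /shortenP[s ps us _] ->].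
  have ltsn : size s < n.
    by have := max_card (mem (a :: s)); rewrite (card_uniqP us) card_ord.
  apply/finset.bigcupP; exists (Ordinal ltsn) => //.
  by apply/imsetP; exists (in_tuple s) => //; rewrite inE us.
apply: leq_trans (subset_leq_card sub) _.
apply: leq_trans (_ : \sum_(k < n) #|ends k| <= _).
  elim/big_rec2: _ => [|k m B _ le_m]; first by rewrite cards0.
  by apply: leq_trans (leq_card_setU _ _) _; rewrite leq_add2l.
by apply: leq_sum => k _; apply: leq_imset_card.
Qed.

Lemma card_final_le {n : nat} (G : {set {set 'I_n}}) (A : {set 'I_n}) :
  #|final G A| <= \sum_(a in A) \sum_(k < n) #|saw G k a|.
Proof.
have sub : final G A \subset
    (\bigcup_(a in A) [set v | connect (adj G) a v])%SET.
  apply/fintype.subsetP => v /final_sub_reach[a aA av].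
  by apply/finset.bigcupP; exists a; rewrite ?inE.
apply: leq_trans (subset_leq_card sub) _.
elim/big_rec2: _ => [|a m B _ le_m]; first by rewrite cards0.
apply: leq_trans (leq_card_setU _ _) (leq_add _ le_m).
by rewrite cardsE; apply: card_component_le.
Qed.

(** * Expectations in the random graph *)

Local Open Scope ring_scope.

Lemma gnp_ge0 {R : realType} {n : nat} (q : R) (G : {set {set 'I_n}}) :
  0 <= q <= 1 -> 0 <= gnp q G.
Proof.
by case/andP=> q0 q1; apply: prodr_ge0 => e _; case: ifP; rewrite ?subr_ge0.
Qed.

(** Give each edge a weight for being present and one for being absent, where
    the absence of an edge of [S] weighs 0: then the graphs that contain [S]
    are the only ones to contribute when the product over all edges of the sum
    of both weights is expanded.  The factors outside [S] are equal to 1. *)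
Lemma sum_gnp_sup {R : realType} {n : nat} (q : R) (S : {set {set 'I_n}}) :
  S \subset all_edges n ->
  \sum_(G in graphs n | S \subset G) gnp q G = q ^+ #|S|.
Proof.
move=> sS.
pose F e : R := if e \in all_edges n then q else 0.
pose H e : R := if e \in S then 0 else if e \in all_edges n then 1 - q else 1.
have FH : \prod_e (F e + H e) = q ^+ #|S|.
  rewrite (bigID (mem S)) /= [X in _ * X]big1 ?mulr1 => [|e /negPf eS].
    rewrite -prodr_const; apply: eq_bigr => e eS.
    by rewrite /F /H eS (fintype.subsetP sS) // addr0.
  by rewrite /F /H eS; case: ifP => _; rewrite ?add0r // subrKC.
rewrite -FH bigA_distr [RHS](bigID (fun G => (G \in graphs n) && (S \subset G))).
rewrite [X in _ = _ + X]big1 ?addr0 => [|G /=]; last first.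
  rewrite powersetE negb_and => /orP[]/subsetPn[e eG eE].
    by rewrite (bigD1 e) //= eG /F (negPf eE) mul0r.
  by rewrite (bigD1 e) //= (negPf eE) /H eG mul0r.
apply: eq_big => [G|G /andP[]]; first by rewrite inE.
rewrite powersetE => sG SG.
rewrite /gnp big_mkcond; apply: eq_bigr => e _; rewrite /F /H.
case: ifP => [eE|/negbT eE]; last first.
  rewrite !ifN //; first by apply: contra eE; exact: (fintype.subsetP sS).
  by apply: contra eE; exact: (fintype.subsetP sG).
by case: ifP => // /negbT eG; rewrite ifN //; apply: contra eG;
  exact: (fintype.subsetP SG).
Qed.

Lemma expected_saw {R : realType} {n : nat} (q : R) (k : nat) (a : 'I_n) :
  0 <= q <= 1 ->
  \sum_(G in graphs n) gnp q G * #|saw G k a|%:R <= (n%:R * q) ^+ k.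
Proof.
move=> q01.
have -> : \sum_(G in graphs n) gnp q G * #|saw G k a|%:R =
    \sum_(s : k.-tuple 'I_n | uniq (a :: s))
      \sum_(G in graphs n | path_edges a s \subset G) gnp q G.
  rewrite (exchange_big_dep (mem (graphs n))) /=; last by move=> s G _ /andP[].
  apply: eq_bigr => G GG; rewrite -sumr_const mulr_sumr mulr1.
  by apply: eq_bigl => s; rewrite inE path_adjE GG.
apply: le_trans (_ : \sum_(s : k.-tuple 'I_n) q ^+ k <= _).
  rewrite big_mkcond /=; apply: ler_sum => s _.
  case: ifP => us; last by case/andP: q01 => q0 _; apply: exprn_ge0.
  by rewrite sum_gnp_sup ?path_edges_sub // card_path_edges // size_tuple.
by rewrite sumr_const card_tuple card_ord exprMn -natrX mulr_natl.
Qed.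

Lemma geometric_sum_le {R : realType} (x : R) (n : nat) :
  0 <= x <= 2^-1 -> \sum_(k < n) x ^+ k <= 1 + 2 * x.
Proof.
move=> /andP[x0 x2]; elim: n => [|n IH]; first by rewrite big_ord0; lra.
rewrite big_ord_recl expr0.
under eq_bigr => i _ do rewrite lift0 exprS.
by rewrite -mulr_sumr; nra.
Qed.

Lemma expected_final {R : realType} {n : nat} (q : R) (A : {set 'I_n}) :
  0 <= q <= 1 -> n%:R * q <= 2^-1 ->
  \sum_(G in graphs n) gnp q G * #|final G A|%:R
    <= #|A|%:R * (1 + 2 * (n%:R * q)).
Proof.
move=> q01 x2.
apply: le_trans (_ : \sum_(G in graphs n) \sum_(a in A) \sum_(k < n)
    gnp q G * #|saw G k a|%:R <= _).
  apply: ler_sum => G _.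
  under eq_bigr => a _ do rewrite -mulr_sumr -natr_sum.
  rewrite -mulr_sumr -natr_sum ler_wpM2l ?gnp_ge0 // ler_nat.
  exact: card_final_le.
rewrite exchange_big /= mulr_natl -sumr_const; apply: ler_sum => a _.
rewrite exchange_big /=.
apply: le_trans (geometric_sum_le (n%:R * q) n _); last first.
  by rewrite x2 mulr_ge0 //; case/andP: q01.
by apply: ler_sum => k _; apply: expected_saw.
Qed.

(** * Markov's inequality *)

(** The excess [|final G A| - |A|] is nonnegative and has expectation at most
    [2 n q |A|].  For empty [A] there is nothing to divide by, but then
    [final G A] is empty and the strict inequality never holds. *)
Lemma gnp_final_large {R : realType} {n : nat} (q eps : R) (A : {set 'I_n}) :
  0 <= q <= 1 -> n%:R * q <= 2^-1 -> 0 < eps ->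
  \sum_(G in graphs n | (1 + eps) * #|A|%:R < #|final G A|%:R) gnp q G
    <= 2 * (n%:R * q) / eps.
Proof.
move=> q01 x2 eps0.
have x0 : 0 <= n%:R * q by rewrite mulr_ge0 //; case/andP: q01.
have [->|A0] := eqVneq A finset.set0.
  rewrite big1 => [|G]; first exact: divr_ge0 (mulr_ge0 _ x0) (ltW eps0).
  by rewrite final0 cards0 mulr0 ltxx andbF.
have a0 : 0 < #|A|%:R :> R by rewrite ltr0n card_gt0.
rewrite ler_pdivlMr // -(ler_pM2r a0) -mulrA mulr_suml.
apply: le_trans (_ : \sum_(G in graphs n)
    (gnp q G * #|final G A|%:R - gnp q G * #|A|%:R) <= _); last first.
  rewrite sumrB -mulr_suml sum_gnp mul1r.
  by have := expected_final q A q01 x2; lra.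
rewrite big_mkcondr /=; apply: ler_sum => G _; rewrite -mulrBr.
case: ifP => [large|_].
  by rewrite ler_wpM2l ?gnp_ge0 //; move: large; lra.
by rewrite mulr_ge0 ?gnp_ge0 // subr_ge0 ler_nat subset_leq_card ?sub_iter_step.
Qed.

Lemma Pr_final_large {R : realType} {n a : nat} (mu : {set 'I_n} -> R)
    (q eps : R) :
  seed_law a mu -> 0 <= q <= 1 -> n%:R * q <= 2^-1 -> 0 < eps ->
  Pr mu q (fun A G => (1 + eps) * a%:R < #|final G A|%:R)
    <= 2 * (n%:R * q) / eps.
Proof.
move=> [mu0 mu1 mua] q01 x2 eps0; rewrite -[leRHS]mul1r -[X in _ <= X * _]mu1 mulr_suml.
apply: ler_sum => A _; rewrite -mulr_sumr.
have [->|/mua <-] := eqVneq (mu A) 0; first by rewrite !mul0r.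
by rewrite ler_wpM2l // gnp_final_large.
Qed.

Lemma Pr_ge0 {R : realType} {n a : nat} (mu : {set 'I_n} -> R) (q : R)
    (E : {set 'I_n} -> {set {set 'I_n}} -> bool) :
  seed_law a mu -> 0 <= q <= 1 -> 0 <= Pr mu q E.
Proof.
by case=> mu0 _ _ q01; do 2!apply: sumr_ge0 => ? _; rewrite mulr_ge0 ?gnp_ge0.
Qed.

(** Initial sets of the wrong size have weight 0. *)
Lemma eq_Pr {R : realType} {n a : nat} (mu : {set 'I_n} -> R) (q : R)
    (E F : {set 'I_n} -> {set {set 'I_n}} -> bool) :
  seed_law a mu -> (forall (A : {set 'I_n}) G, #|A| = a -> E A G = F A G) ->
  Pr mu q E = Pr mu q F.
Proof.
case=> _ _ mua EF; apply: eq_bigr => A _; rewrite -!mulr_sumr.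
have [->|/mua Aa] := eqVneq (mu A) 0; first by rewrite !mul0r.
by congr (_ * _); apply: eq_bigl => G; rewrite EF.
Qed.

Local Open Scope classical_set_scope.
Local Open Scope ring_scope.

Theorem theorem3p1 (R : realType) (p : nat -> R) (A0 : nat -> nat)
    (mu : forall n : nat, {set 'I_n} -> R)
    (p01 : forall n : nat, 0 <= p n <= 1)
    (p_small : p =o_\oo (fun n : nat => n%:R^-1 : R))
    (mu_law : forall n : nat, seed_law (A0 n) (mu n)) :
  (forall eps : R, 0 < eps ->
    (fun n : nat => Pr (mu n) (p n)
       (fun A G => (1 + eps) * (A0 n)%:R < #|final G A|%:R)) @ \oo --> (0 : R))
  /\
  (exists X : forall n : nat, {set 'I_n} -> {set {set 'I_n}} -> R,
    (forall (n : nat) (A : {set 'I_n}) (G : {set {set 'I_n}}),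
       #|A| = A0 n -> G \in graphs n ->
       #|final G A|%:R = (A0 n)%:R * (1 + X n A G)) /\
    (forall delta : R, 0 < delta ->
       (fun n : nat => Pr (mu n) (p n)
          (fun A G => delta < `|X n A G|)) @ \oo --> (0 : R))).
Proof.
have large (eps : R) : 0 < eps -> (fun n : nat => Pr (mu n) (p n)
    (fun A G => (1 + eps) * (A0 n)%:R < #|final G A|%:R)) @ \oo --> (0 : R).
  move=> eps0; apply/cvgrPdist_le => d d0.
  (* n p(n) <= 1/2 makes the geometric series converge, and
     n p(n) <= d eps / 2 makes the Markov bound 2 n p(n) / eps at most d *)
  pose c := Num.min 2^-1 (d * eps / 2).
  have c0 : 0 < c by rewrite lt_min invr_gt0 ltr0n divr_gt0 ?mulr_gt0.
  move/eqoP: p_small => /(_ _ c0) small.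
  near=> n.
  have n0 : (0 : R) < n%:R by rewrite ltr0n; near: n; exists 1%N.
  have pn0 : 0 <= p n by case/andP: (p01 n).
  have xc : n%:R * p n <= c.
    have : `|p n| <= c * `|n%:R^-1| by near: n.
    by rewrite (ger0_norm pn0) ger0_norm // ler_pdivlMr // mulrC.
  move: xc; rewrite le_min => /andP[x2 xd].
  rewrite sub0r normrN ger0_norm; last exact: Pr_ge0 (mu_law n) (p01 n).
  apply: le_trans (Pr_final_large _ _ _ (mu_law n) (p01 n) x2 eps0) _.
  by rewrite ler_pdivrMr //; lra.
split=> //.
exists (fun n A G =>
  if A0 n == 0%N then 0 else #|final G A|%:R / (A0 n)%:R - 1); split.
  move=> n A G Aa _; case: eqP => [a0|/eqP a0].
    move: Aa; rewrite a0 => /eqP; rewrite cards_eq0 => /eqP ->.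
    by rewrite final0 cards0 mul0r.
  by rewrite subrKC mulrC divfK // pnatr_eq0.
move=> delta delta0.
rewrite (_ : (fun n : nat => _) = fun n : nat => Pr (mu n) (p n)
    (fun A G => (1 + delta) * (A0 n)%:R < #|final G A|%:R)); first exact: large.
apply/funext => n; apply: eq_Pr (mu_law n) _ => A G Aa.
case: eqP => [a0|/eqP a0].
  move: Aa; rewrite a0 => /eqP; rewrite cards_eq0 => /eqP ->.
  by rewrite final0 cards0 mulr0 normr0 ltxx ltNge ltW.
have a_gt0 : 0 < (A0 n)%:R :> R by rewrite ltr0n lt0n.
have le_final : (A0 n)%:R <= #|final G A|%:R :> R.
  by rewrite -Aa ler_nat subset_leq_card ?sub_iter_step.
rewrite ger0_norm; last by rewrite subr_ge0 ler_pdivlMr // mul1r.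
by rewrite ltrBrDl ltr_pdivlMr.
Unshelve. all: by end_near.
Qed.
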